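(* Let $N\ge4$ and let $A\in\mathbb{R}^{Nn\times Nn}$ be a symmetric block tridiagonal matrix with diagonal blocks $b_k\in\mathbb{R}^{n\times n}$ ($k=1,\dots,N$), blocks $c_k\in\mathbb{R}^{n\times n}$ in block position $(k,k-1)$ and $c_k^{\mathrm T}$ in block position $(k-1,k)$ ($k=2,\dots,N$), and all other blocks zero. Suppose $\alpha_L,\alpha_U$ are real numbers with $$0<\alpha_L\le\lambda_{\min}(A)\le\lambda_{\max}(A)\le\alpha_U.$$ Then the same bounds apply to all blocks $d_k^f$, $d_k^b$ of the new two filter block tridiagonal algorithm described in the context: $\alpha_L\le\lambda_{\min}(d_k^f)\le\lambda_{\max}(d_k^f)\le\alpha_U$ for $1\le k\le\lfloor N/2\rfloor-1$, and $\alpha_L\le\lambda_{\min}(d_k^b)\le\lambda_{\max}(d_k^b)\le\alpha_U$ for $\lfloor N/2\rfloor\le k\le N$.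
   Context: $\lambda_{\min},\lambda_{\max}$ denote the minimum and maximum eigenvalues of a symmetric matrix. The new two filter block tridiagonal algorithm computes its blocks as follows: starting from $d_1^f=b_1$, for $k=2,\dots,\lfloor N/2\rfloor-1$ it sets $d_k^f=b_k-c_k(d_{k-1}^f)^{-1}c_k^{\mathrm T}$; and, starting from $d_N^b=b_N$, for $k=N-1,\dots,\lfloor N/2\rfloor$ it sets $d_k^b=b_k-c_{k+1}^{\mathrm T}(d_{k+1}^b)^{-1}c_{k+1}$. (These two recursions meet in the middle; the system is then decoupled and finished by back substitution in each half.) *)

(* Defs.v *)
From HB Require Import structures.
From mathcomp Require Import all_boot all_order all_algebra.
From mathcomp Require Import boolp classical_sets reals.
From mathcomp Require Import polyrcf complex.
Set Implicit Arguments.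
Unset Strict Implicit.
Unset Printing Implicit Defensive.
Import Order.TTheory GRing.Theory Num.Theory.
Local Open Scope classical_set_scope.
Local Open Scope ring_scope.

(* For symmetric A with m > 0 these are attained, i.e., they are the minimum
   and maximum of the spectrum: see lambda_minP and lambda_maxP below. For
   m = 0 both are inf/sup of the empty set, i.e., 0. *)
Definition lambda_min (R : realType) (m : nat) (A : 'M[R]_m) : R :=
  inf [set a | eigenvalue A a].

Definition lambda_max (R : realType) (m : nat) (A : 'M[R]_m) : R :=
  sup [set a | eigenvalue A a].

(* The blocks b_1, ..., b_N and c_2, ..., c_N keep their 1-based indices (other
   values of b and c are irrelevant), whereas i, j : 'I_N count from 0. *)
Definition block_tridiag (R : realType) (n N : nat) (b c : nat -> 'M[R]_n) :
    'M[R]_(\sum_(i < N) n) :=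
  \mxblock_(i < N, j < N)
    (if i == j :> nat then b i.+1
     else if i == j.+1 :> nat then c i.+1
     else if j == i.+1 :> nat then (c j.+1)^T
     else 0).

(* df and db are the blocks produced by the two recursions, with N./2 the
   integer part of N/2; nothing is said of df and db outside the ranges on
   which the algorithm computes them. *)
Definition two_filter (R : realType) (n N : nat) (b c : nat -> 'M[R]_n)
    (df db : nat -> 'M[R]_n) : Prop :=
  [/\ df 1%N = b 1%N,
      forall k, (2 <= k <= N./2 - 1)%N ->
        df k = b k - c k *m invmx (df k.-1) *m (c k)^T,
      db N = b N
    & forall k, (N./2 <= k <= N.-1)%N ->
        db k = b k - (c k.+1)^T *m invmx (db k.+1) *m c k.+1].

Section Spectrum.
Variable R : realType.

Lemma sym_eigenvalue_exists (m : nat) (A : 'M[R]_m) :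
  (0 < m)%N -> A^T = A -> exists a, eigenvalue A a.
Proof.
move=> m0 As.
pose C : numClosedFieldType := R[i]%C.
pose h : {rmorphism R -> C} := real_complex R.
have [a /eigenvalueP[v va v0]] : exists a : C, eigenvalue (map_mx h A) a.
  exact: Theorem7'.
pose w : 'cV[C]_m := (map_mx Num.conj v)^T.
pose s : C := (v *m w) 0 0.
have s0 : s != 0.
  rewrite /s mxE; apply/eqP => /eqP; rewrite psumr_eq0; last first.
    by move=> i _; rewrite !mxE -normCK exprn_ge0.
  move=> /allP H; move/eqP: v0; apply; apply/rowP => i; rewrite !mxE.
  have := H i (mem_index_enum _); rewrite !mxE -normCK expf_eq0 /= normr_eq0.
  by move/eqP.
have hA : map_mx Num.conj (map_mx h A) = map_mx h A.
  by apply/matrixP => i j; rewrite !mxE; apply: conjc_real.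
have hAT : (map_mx h A)^T = map_mx h A by rewrite map_trmx As.
have hw : map_mx Num.conj w = v^T.
  by apply/matrixP => i j; rewrite !mxE conjCK.
have Aw : map_mx h A *m w = Num.conj a *: w.
  have := congr1 (fun M => (map_mx Num.conj M)^T) va.
  by rewrite map_mxM hA trmx_mul hAT map_mxZ linearZ.
have aR : Num.conj a = a.
  have : v *m map_mx h A *m w = v *m (map_mx h A *m w) by rewrite mulmxA.
  rewrite va Aw -scalemxAl -scalemxAr => /matrixP/(_ 0 0).
  by rewrite [LHS]mxE [RHS]mxE => /(mulIf s0).
have [r ar] : exists r, a = h r.
  by apply/complex_realP; rewrite CrealE; apply/eqP.
exists r; rewrite -(eigenvalue_map h); apply/eigenvalueP.
by exists v; rewrite // -ar.
Qed.

Lemma eigenvalue_seq (m : nat) (A : 'M[R]_m) :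
  exists s : seq R, forall a, eigenvalue A a = (a \in s).
Proof.
exists (rootsR (char_poly A)) => a.
have := roots_on_rootsR (monic_neq0 (char_poly_monic A)) a.
by rewrite eigenvalue_root_char => <-; rewrite in_itv.
Qed.

Lemma lambda_minP (m : nat) (A : 'M[R]_m) : (0 < m)%N -> A^T = A ->
  eigenvalue A (lambda_min A) /\
  forall a, eigenvalue A a -> lambda_min A <= a.
Proof.
move=> m0 As; have [a Aa] := sym_eigenvalue_exists m0 As.
have [s As_] := eigenvalue_seq A.
have [z zs zmin] : exists2 z, z \in s & {in s, forall x, z <= x}.
  move: Aa; rewrite As_; elim: s {As_} a => // x s IH a _.
  case: s IH => [_|y s /(_ y (mem_head _ _))[z zs zmin]].
    by exists x; rewrite ?mem_head// => t; rewrite inE => /eqP->.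
  exists (Num.min x z).
    by rewrite inE; case: leP; rewrite ?eqxx// zs orbT.
  move=> t; rewrite inE ge_min => /orP[/eqP->|/zmin ->]; rewrite ?lexx//.
  by rewrite orbT.
have -> : lambda_min A = z.
  apply/eqP; rewrite eq_le; apply/andP; split.
    by apply: ge_inf; [exists z => x /=|]; rewrite /= As_//; apply: zmin.
  apply: lb_le_inf; first by exists z; rewrite /= As_.
  by move=> x /=; rewrite As_; apply: zmin.
by split=> [|x]; rewrite As_//; apply: zmin.
Qed.

Lemma lambda_maxP (m : nat) (A : 'M[R]_m) : (0 < m)%N -> A^T = A ->
  eigenvalue A (lambda_max A) /\
  forall a, eigenvalue A a -> a <= lambda_max A.
Proof.
move=> m0 As; have [a Aa] := sym_eigenvalue_exists m0 As.
have [s As_] := eigenvalue_seq A.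
have [z zs zmax] : exists2 z, z \in s & {in s, forall x, x <= z}.
  move: Aa; rewrite As_; elim: s {As_} a => // x s IH a _.
  case: s IH => [_|y s /(_ y (mem_head _ _))[z zs zmax]].
    by exists x; rewrite ?mem_head// => t; rewrite inE => /eqP->.
  exists (Num.max x z).
    by rewrite inE; case: leP; rewrite ?eqxx// zs orbT.
  move=> t; rewrite inE le_max => /orP[/eqP->|/zmax ->]; rewrite ?lexx//.
  by rewrite orbT.
have -> : lambda_max A = z.
  apply/eqP; rewrite eq_le; apply/andP; split.
    apply: ge_sup; first by exists z; rewrite /= As_.
    by move=> x /=; rewrite As_; apply: zmax.
  by apply: ub_le_sup; [exists z => x /=|]; rewrite /= As_//; apply: zmax.
by split=> [|x]; rewrite As_//; apply: zmax.
Qed.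

End Spectrum.

(* The bounded blocks are symmetric, so lambda_minP and lambda_maxP apply to
   them. *)
Section Symmetry.
Variables (R : realType) (n N : nat) (b c : nat -> 'M[R]_n).

Lemma block_tridiag_sym : (block_tridiag N b c)^T = block_tridiag N b c ->
  forall k, (1 <= k <= N)%N -> (b k)^T = b k.
Proof.
move=> As [//|k] /= kN; pose i := Ordinal kN.
have := tr_submxblock (block_tridiag N b c) i i.
by rewrite As mxblockK eqxx.
Qed.

Lemma two_filter_sym (df db : nat -> 'M[R]_n) : (1 < N)%N ->
  (block_tridiag N b c)^T = block_tridiag N b c ->
  two_filter N b c df db ->
  (forall k, (1 <= k <= N./2 - 1)%N -> (df k)^T = df k) /\
  (forall k, (N./2 <= k <= N)%N -> (db k)^T = db k).
Proof.
move=> N1 /block_tridiag_sym bs [f1 fS bN bS].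
have N2 : (0 < N./2 <= N)%N.
  by rewrite half_gt0 N1 -{2}[N]odd_double_half -addnn addnA leq_addl.
split=> [|k /andP[Nk kN]].
  elim=> [//|[_ _|k IH]]; first by rewrite f1 bs// (ltnW N1).
  move=> /andP[_ kN]; rewrite fS// linearB /= bs; last first.
    by rewrite /=; case/andP: N2 => _; apply/leq_trans/(leq_trans kN)/leq_subr.
  by rewrite !trmx_mul trmx_inv trmxK IH ?mulmxA//= ltnW.
have -> : k = (N - (N - k))%N by rewrite subKn.
have : (N - k <= N - N./2)%N by rewrite leq_sub2l.
elim: (N - k)%N => [_|j IH jN]; first by rewrite subn0 bN bs// leqnn (ltnW N1).
have jN' : (j < N)%N by apply: leq_trans jN (leq_subr _ _).
have lo : (N./2 <= N - j.+1)%N.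
  by rewrite -(subKn (proj2 (andP N2))) leq_sub2l.
have hi : (N - j.+1 <= N.-1)%N by rewrite -subn1 leq_sub2l.
rewrite bS ?lo// -subSn// subSS linearB /= bs; last first.
  by rewrite leq_subr andbT (leq_trans _ lo)//; case/andP: N2.
by rewrite !trmx_mul trmx_inv trmxK IH ?mulmxA// ltnW.
Qed.

End Symmetry.

(* Main.v *)
Require Import Defs.
From HB Require Import structures.
From mathcomp Require Import all_boot all_order all_algebra.
From mathcomp Require Import boolp classical_sets reals.
From mathcomp Require Import zify complex sesquilinear spectral.
Import Order.TTheory GRing.Theory Num.Theory.
Local Open Scope ring_scope.

(** For a symmetric matrix M, having its spectrum in [aL, aU] is the same as
    aL |x|^2 <= x M x^T <= aU |x|^2 for every row vector x (lambda_form_between,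
    form_between_lambda), so the theorem is a statement about quadratic forms.

    Let d_1, ..., d_K be the pivots of block elimination of A from the top. By
    induction on k, the form of d_k lies between the same bounds as that of A:

    - Upper bound.  d_k is b_k minus c_k d_(k-1)^-1 c_k^T, whose form is
      nonnegative since d_(k-1) is positive definite (qform_invmx_conj), and
      the form of b_k is that of A on vectors living in block k alone.

    - Lower bound.  d_k is a Schur complement: every x is the k-th block of
      some v, zero beyond block k, whose earlier blocks are chosen so that v A
      vanishes in all blocks before the k-th and equals x d_k there
      (elimination).  Hence x d_k x^T = v A v^T >= aL |v|^2 >= aL |x|^2.

    Positivity of aL makes each pivot invertible, so the recursion can go on.
    The backward filter is the forward filter of the matrix read from the
    bottom right corner, where b_k becomes b_(N+1-k) and c_k becomes
    c_(N+2-k)^T; reversing the blocks of a vector shows that this matrix has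
    the same form bounds (block_form_between_rev). *)

(** * Spectral bounds as bounds on the quadratic form *)

Section FormBounds.
Context {R : realType}.

Definition qform {m} (M : 'M[R]_m) (x : 'rV[R]_m) : R := (x *m M *m x^T) 0 0.

Definition sqnorm {m} (x : 'rV[R]_m) : R := (x *m x^T) 0 0.

Definition form_between (aL aU : R) {m} (M : 'M[R]_m) : Prop :=
  forall x, aL * sqnorm x <= qform M x <= aU * sqnorm x.

Lemma sqnormE {m} (x : 'rV[R]_m) : sqnorm x = \sum_i x 0 i ^+ 2.
Proof. by rewrite /sqnorm mxE; apply: eq_bigr => i _; rewrite mxE expr2. Qed.

Lemma sqnorm_ge0 {m} (x : 'rV[R]_m) : 0 <= sqnorm x.
Proof. by rewrite sqnormE sumr_ge0 // => i _; apply: sqr_ge0. Qed.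

Lemma sqnorm_eq0 {m} (x : 'rV[R]_m) : (sqnorm x == 0) = (x == 0).
Proof.
rewrite sqnormE; apply/eqP/eqP => [x0|->]; last first.
  by apply: big1 => i _; rewrite mxE expr0n.
apply/rowP => i; rewrite mxE; apply/eqP; rewrite -sqrf_eq0; apply/eqP.
by move: i isT; apply: psumr_eq0P => // i _; apply: sqr_ge0.
Qed.

Lemma qformB {m} (M M' : 'M[R]_m) x : qform (M - M') x = qform M x - qform M' x.
Proof. by rewrite /qform mulmxBr mulmxBl mxE [(- _ : 'M_1) _ _]mxE. Qed.

Lemma form_between_lambda (aL aU : R) {m} (M : 'M[R]_m) :
  (0 < m)%N -> M^T = M -> form_between aL aU M ->
  [/\ aL <= lambda_min M, lambda_min M <= lambda_max M & lambda_max M <= aU].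
Proof.
move=> m0 Ms Mb.
have [minM minP] := lambda_minP m0 Ms.
have [maxM _] := lambda_maxP m0 Ms.
have eigen_between a : eigenvalue M a -> aL <= a <= aU.
  case/eigenvalueP => v va v0; have := Mb v.
  rewrite /qform va -scalemxAl mxE -/(sqnorm v).
  have v_gt0 : 0 < sqnorm v by rewrite lt0r sqnorm_eq0 v0 sqnorm_ge0.
  by rewrite !ler_pM2r.
split; first by case/andP: (eigen_between _ minM).
- exact: minP.
- by case/andP: (eigen_between _ maxM).
Qed.

(** The spectral theorem over R[i]: in an orthonormal eigenbasis of M, with w
    the coordinates of x, the form is the sum of the D_i |w_i|^2, and every
    D_i is a real eigenvalue of M. *)
Lemma lambda_form_between (aL aU : R) {m} (M : 'M[R]_m) :
  (0 < m)%N -> M^T = M -> aL <= lambda_min M -> lambda_max M <= aU ->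
  form_between aL aU M.
Proof.
move=> m0 Ms minM maxM x.
have eigen_between a : eigenvalue M a -> aL <= a <= aU.
  move=> Ma; rewrite (le_trans minM) ?(le_trans _ maxM) //.
    exact: (lambda_maxP m0 Ms).2.
  exact: (lambda_minP m0 Ms).2.
pose h : {rmorphism R -> R[i]%C} := real_complex R.
pose Mc := map_mx h M; pose v := map_mx h x.
have hconj p q (B : 'M[R]_(p, q)) : map_mx Num.conj (map_mx h B) = map_mx h B.
  by apply/matrixP => i j; rewrite !mxE; apply: conjc_real.
have Mherm : Mc \is hermsymmx.
  apply/is_hermitianmxP; rewrite expr0 scale1r.
  by rewrite -map_trmx hconj map_trmx Ms.
have Dreal := hermitian_spectral_diag_real Mherm.
have /hermitian_normalmx/orthomx_spectralP := Mherm.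
set P := spectralmx Mc; set D := spectral_diag Mc => ME.
have Pu : P \is unitarymx by exact: spectral_unitarymx.
have Punit : P \in unitmx by exact: unitarymx_unit.
have Drange i : exists2 r, D 0 i = h r & aL <= r <= aU.
  have /complex_realP[r Dr] : D 0 i \is Num.real by exact: (mxOverP Dreal).
  exists r => //; apply: eigen_between; rewrite -(eigenvalue_map h).
  apply/eigenvalueP; exists (row i P).
    rewrite -/Mc -row_mul ME !mulmxA mulmxV // mul1mx.
    by rewrite row_mul row_diag_mx -scalemxAl -rowE Dr.
  apply/eqP => /(congr1 (mulmx^~ (invmx P))).
  rewrite -row_mul mulmxV // mul0mx => /rowP/(_ i).
  by rewrite !mxE eqxx => /eqP; rewrite oner_eq0.
(* The coordinates of v in the eigenbasis formed by the rows of P. *)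
pose w := v *m map_mx Num.conj P^T.
have vw : v = w *m P by rewrite /w -invmx_unitary // mulmxKV.
pose w' := map_mx Num.conj w^T.
have vT : v^T = invmx P *m w'.
  rewrite invmx_unitary // -map_mxM -trmx_mul -vw.
  by rewrite -map_trmx hconj.
have sqE : h (sqnorm x) = \sum_i `|w 0 i| ^+ 2.
  have -> : h (sqnorm x) = (v *m v^T) 0 0.
    by rewrite map_trmx -map_mxM mxE.
  rewrite vT vw mulmxA mulmxK // mxE.
  by apply: eq_bigr => i _; rewrite !mxE -normCK.
have qfE : h (qform M x) = \sum_i D 0 i * `|w 0 i| ^+ 2.
  have -> : h (qform M x) = (v *m Mc *m v^T) 0 0.
    by rewrite map_trmx -!map_mxM mxE.
  rewrite ME vT vw !mulmxA mulmxK // mulmxK // mxE.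
  apply: eq_bigr => i _; rewrite mul_mx_diag !mxE.
  by rewrite mulrAC -normCK mulrC.
rewrite -!lecR !rmorphM /= -/(h _) sqE qfE !mulr_sumr.
apply/andP; split; apply: ler_sum => i _.
  have [r -> /andP[rL _]] := Drange i.
  by rewrite ler_wpM2r ?exprn_ge0 // lecR.
have [r -> /andP[_ rU]] := Drange i.
by rewrite ler_wpM2r ?exprn_ge0 // lecR.
Qed.
End FormBounds.

(** * Block vectors and pivots *)

Section BlockForms.
Context {R : realType} {n : nat}.
Implicit Types (b c d : nat -> 'M[R]_n) (v : nat -> 'rV[R]_n) (x : 'rV[R]_n).

(** Block (i, j), counted from 0, of block_tridiag, for arbitrary natural
    numbers i and j so that no bound has to be carried along. *)
Definition tridiag_block b c (i j : nat) : 'M[R]_n :=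
  if i == j then b i.+1
  else if i == j.+1 then c i.+1
  else if j == i.+1 then (c j.+1)^T
  else 0.

(** Block vectors are functions on nat, of which the first N values matter;
    T plays the role of an N x N block matrix. *)
Definition block_mul N (T : nat -> nat -> 'M[R]_n) v (j : nat) : 'rV[R]_n :=
  \sum_(i < N) v i *m T i j.

Definition block_form N (T : nat -> nat -> 'M[R]_n) v : R :=
  \sum_(j < N) (block_mul N T v j *m (v j)^T) 0 0.

Definition block_form_between (aL aU : R) N
    (T : nat -> nat -> 'M[R]_n) : Prop :=
  forall v, aL * (\sum_(i < N) sqnorm (v i)) <= block_form N T v
            <= aU * (\sum_(i < N) sqnorm (v i)).

Lemma block_tridiag_form_between (aL aU : R) N b c :
  form_between aL aU (block_tridiag N b c) ->
  block_form_between aL aU N (tridiag_block b c).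
Proof.
move=> H v; have := H (\mxrow_(i < N) v i).
rewrite /sqnorm /qform /block_tridiag mul_mxrow_mxblock tr_mxrow.
by rewrite !mul_mxrow_mxcol !summxE.
Qed.

Definition single (k : nat) x (i : nat) : 'rV[R]_n := if i == k then x else 0.

Lemma block_mul_single N T k x j : (k < N)%N ->
  block_mul N T (single k x) j = x *m T k j.
Proof.
move=> kN; rewrite /block_mul (bigD1 (Ordinal kN)) //= big1 ?addr0.
  by rewrite /single eqxx.
by move=> i ik; rewrite /single ifN ?mul0mx.
Qed.

(** In v T v^T, block j of v T meets block j of v, and j = k is the only index
    at which neither has to vanish. *)
Lemma block_formE N T v k y : (k < N)%N ->
  (forall i, (k < i)%N -> v i = 0) ->
  (forall j, (j < k)%N -> block_mul N T v j = 0) ->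
  block_mul N T v k = y ->
  block_form N T v = (y *m (v k)^T) 0 0.
Proof.
move=> kN vk Tv Tk; rewrite /block_form (bigD1 (Ordinal kN)) //= Tk.
rewrite big1 ?addr0 // => j; rewrite -val_eqE /= neq_ltn => /orP[/Tv->|/vk->].
  by rewrite mul0mx mxE.
by rewrite trmx0 mulmx0 mxE.
Qed.

Lemma sqnorm_le_sum N v k : (k < N)%N ->
  sqnorm (v k) <= \sum_(i < N) sqnorm (v i).
Proof.
move=> kN; rewrite (bigD1 (Ordinal kN)) //= lerDl.
by apply: sumr_ge0 => i _; apply: sqnorm_ge0.
Qed.

Lemma diag_block_le (aL aU : R) N b c k x : (k < N)%N ->
  block_form_between aL aU N (tridiag_block b c) ->
  qform (b k.+1) x <= aU * sqnorm x.
Proof.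
move=> kN /(_ (single k x))/andP[_].
have -> : block_form N (tridiag_block b c) (single k x) = qform (b k.+1) x.
  rewrite /block_form (bigD1 (Ordinal kN)) //= big1 ?addr0.
    by rewrite block_mul_single // /tridiag_block /single !eqxx.
  move=> i; rewrite -val_eqE /= => ik.
  by rewrite /single (negPf ik) trmx0 mulmx0 mxE.
congr (_ <= _ * _); rewrite (bigD1 (Ordinal kN)) //= big1 ?addr0.
  by rewrite /single eqxx.
move=> i; rewrite -val_eqE /= => ik; rewrite /single (negPf ik).
by apply/eqP; rewrite sqnorm_eq0.
Qed.

Lemma form_between_unit (aL aU : R) (M : 'M[R]_n) :
  0 < aL -> form_between aL aU M -> M \in unitmx.
Proof.
move=> aL0 HM; rewrite -row_free_unit -kermx_eq0; apply/eqP/row_matrixP => i.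
rewrite row0; have /andP[+ _] := HM (row i (kermx M)).
rewrite /qform -row_mul mulmx_ker row0 mul0mx mxE pmulr_rle0 // => le0.
by apply/eqP; rewrite -sqnorm_eq0 eq_le le0 sqnorm_ge0.
Qed.

(** Both filters are instances: the forward one directly, the backward one
    after reversing the order of the blocks. *)
Definition pivots K b c d : Prop :=
  d 1%N = b 1%N /\
  forall k, (2 <= k <= K)%N -> d k = b k - c k *m invmx (d k.-1) *m (c k)^T.

(** Back substitution: block k of v being x, block k-1 has to be
    -(x c d^-1) for block k-1 of the product to cancel, and so on upwards. The
    block k+1 of the product is recorded because it is what the next step has
    to cancel. *)
Lemma elimination N K b c d k : (K <= N)%N -> pivots K b c d -> (k < K)%N ->
  (forall j, (j < k)%N -> d j.+1 \in unitmx) ->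
  forall x, exists v, [/\ v k = x, forall i, (k < i)%N -> v i = 0
    & forall j, block_mul N (tridiag_block b c) v j =
        if j == k then x *m d k.+1
        else if j == k.+1 then x *m (c k.+2)^T else 0].
Proof.
move=> KN [d1 dS]; elim: k => [K0 _ x|k IH kK du x].
  exists (single 0 x); split=> [|[]//|j].
    by rewrite /single eqxx.
  rewrite block_mul_single ?(leq_trans K0) // /tridiag_block d1.
  by case: j => [|[|j]] //=; rewrite mulmx0.
have [|v [vk v0 vT]] := IH (ltnW kK) _ (- (x *m c k.+2 *m invmx (d k.+1))).
  by move=> j jk; apply/du/ltnW.
exists (fun i => v i + single k.+1 x i); split=> [|i ki|j].
- by rewrite v0 // /single eqxx add0r.
- by rewrite v0 ?(ltnW ki) // /single gtn_eqF // addr0.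
have -> : block_mul N (tridiag_block b c) (fun i => v i + single k.+1 x i) j =
    block_mul N (tridiag_block b c) v j +
    block_mul N (tridiag_block b c) (single k.+1 x) j.
  by rewrite -big_split /=; apply: eq_bigr => i _; rewrite mulmxDl.
rewrite block_mul_single ?(leq_trans kK) // vT /tridiag_block.
have [->|jk] := eqVneq j k.
  rewrite !eqxx (gtn_eqF (ltnSn k)) (ltn_eqF (ltnSn k)).
  by rewrite (ltn_eqF (ltnW _)) // mulNmx mulmxKV ?du // addNr.
have [_|jk1] := eqVneq j k.+1.
  by rewrite (dS k.+2) // mulmxBr mulNmx addrC !mulmxA.
rewrite add0r.
case: eqP => [[jk2]|_]; first by rewrite jk2 eqxx in jk.
by case: eqP => [->|_]; rewrite ?mulmx0.
Qed.

(** This makes the term subtracted in a pivot nonnegative as soon as the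
    previous pivot is positive definite. *)
Lemma qform_invmx_conj (M C : 'M[R]_n) x : M \in unitmx ->
  qform (C *m invmx M *m C^T) x = qform M (x *m C *m invmx M).
Proof.
(* The left side involves M^-1 and the right side M^-T; a 1 x 1 matrix equals
   its transpose. *)
move=> Mu; have tr00 (B : 'M[R]_1) : B 0 0 = B^T 0 0 by rewrite mxE.
rewrite /qform mulmxKV // tr00 !trmx_mul !trmxK trmx_inv.
by rewrite !mulmxA.
Qed.

Lemma pivots_form_between (aL aU : R) N K b c d : 0 < aL -> (K <= N)%N ->
  pivots K b c d -> block_form_between aL aU N (tridiag_block b c) ->
  forall k, (k < K)%N -> form_between aL aU (d k.+1).
Proof.
move=> aL0 KN dP Hb; elim/ltn_ind => k IH kK x; have kN := leq_trans kK KN.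
have du j : (j < k)%N -> d j.+1 \in unitmx.
  by move=> jk; apply: form_between_unit aL0 (IH j jk (ltn_trans jk kK)).
apply/andP; split.
  have [v [vk v0 vT]] := elimination _ _ _ _ _ _ KN dP kK du x.
  have <- : block_form N (tridiag_block b c) v = qform (d k.+1) x.
    have vTk : block_mul N (tridiag_block b c) v k = x *m d k.+1.
      by rewrite vT eqxx.
    rewrite (block_formE _ _ _ _ _ kN v0 _ vTk) ?vk //.
    by move=> j jk; rewrite vT (ltn_eqF jk) (ltn_eqF (leqW jk)).
  have /andP[+ _] := Hb v; apply: le_trans.
  by rewrite ler_pM2l // -vk sqnorm_le_sum.
apply: le_trans (diag_block_le _ _ _ _ _ _ x kN Hb).
case: dP => d1 dS; case: k IH kK kN du => [|k] IH kK kN du; first by rewrite d1.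
rewrite dS // qformB lerBlDr lerDl.
rewrite qform_invmx_conj ?du //.
have /andP[+ _] := IH k (ltnSn k) (ltnW kK) (x *m c k.+2 *m invmx (d k.+1)).
by apply: le_trans; rewrite mulr_ge0 ?sqnorm_ge0 // ltW.
Qed.

(** Reversal sends block (i, j) to block (N-1-i, N-1-j), which exchanges the
    two off-diagonals; hence the transpose and the shift from N.+1 to N.+2. *)
Lemma block_form_between_rev (aL aU : R) N b c :
  block_form_between aL aU N (tridiag_block b c) ->
  block_form_between aL aU N
    (tridiag_block (fun k => b (N.+1 - k)%N) (fun k => (c (N.+2 - k)%N)^T)).
Proof.
move=> H v; set T := tridiag_block _ _; have := H (fun i => v (N - i.+1)%N).
have blockE (i j : 'I_N) :
    tridiag_block b c (rev_ord i) (rev_ord j) = T i j.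
  case: i j => i iN [j jN]; rewrite /T /tridiag_block /=.
  have -> : ((N - i.+1 == N - j.+1) = (i == j))%N by apply/eqP/eqP; lia.
  have -> : ((N - i.+1 == (N - j.+1).+1) = (j == i.+1))%N by apply/eqP/eqP; lia.
  have -> : ((N - j.+1 == (N - i.+1).+1) = (i == j.+1))%N by apply/eqP/eqP; lia.
  case: (eqVneq i j) => [->|_] /=; first by congr (b _); lia.
  case: (eqVneq i j.+1) => [ij|_] /=.
    by rewrite ifN; [congr ((c _)^T); lia | apply/eqP; lia].
  by case: eqP => // ji; rewrite trmxK; congr (c _); lia.
rewrite (reindex_inj rev_ord_inj) /=.
have sqE : \sum_(j < N) sqnorm (v (N - (N - j.+1).+1)%N)
         = \sum_(i < N) sqnorm (v i).
  by apply: eq_bigr => i _; congr (sqnorm (v _)); have := ltn_ord i; lia.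
rewrite sqE; suff -> :
    block_form N (tridiag_block b c) (fun i => v (N - i.+1)%N) =
    block_form N T v by [].
rewrite /block_form (reindex_inj rev_ord_inj) /=; apply: eq_bigr => j _.
have vrev (i : 'I_N) : v (N - (N - i.+1).+1)%N = v i.
  by congr v; have := ltn_ord i; lia.
rewrite vrev /block_mul (reindex_inj rev_ord_inj) /=; congr ((_ *m _) _ _).
by apply: eq_bigr => i _; rewrite vrev -blockE.
Qed.

End BlockForms.

(** * The bounds on both filters *)

(** Since 0 < aL, this excludes n = 0 from the theorem, a case in which
    lambda_minP would not apply. *)
Lemma lambda_min_dim0 (R : realType) m (M : 'M[R]_m) : m = 0%N ->
  lambda_min M = 0.
Proof.
move=> m0; rewrite /lambda_min (_ : [set a | _]%classic = set0) ?inf0 //.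
apply/seteqP; split=> // a /eigenvalueP[v _]; subst m.
by rewrite thinmx0 eqxx.
Qed.

Theorem mainTheorem11 (R : realType) (n N : nat) (hN : (4 <= N)%N)
    (b c : nat -> 'M[R]_n) (A : 'M[R]_(\sum_(i < N) n))
    (hAsym : A^T = A) (hA : A = block_tridiag N b c)
    (aL aU : R)
    (haL : 0 < aL) (hmin : aL <= lambda_min A)
    (hminmax : lambda_min A <= lambda_max A) (hmax : lambda_max A <= aU)
    (df db : nat -> 'M[R]_n) (hd : two_filter N b c df db) :
  (forall k : nat, (1 <= k <= N./2 - 1)%N ->
     [/\ aL <= lambda_min (df k), lambda_min (df k) <= lambda_max (df k)
       & lambda_max (df k) <= aU]) /\
  (forall k : nat, (N./2 <= k <= N)%N ->
     [/\ aL <= lambda_min (db k), lambda_min (db k) <= lambda_max (db k)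
       & lambda_max (db k) <= aU]).
Proof.
have n0 : (0 < n)%N.
  rewrite lt0n; apply/eqP => n0; move: hmin; rewrite lambda_min_dim0.
    by rewrite leNgt haL.
  by rewrite sum_nat_const n0 muln0.
have dim0 : (0 < \sum_(i < N) n)%N.
  by rewrite sum_nat_const card_ord muln_gt0 n0 andbT; lia.
have Hb : block_form_between aL aU N (tridiag_block b c).
  by apply: block_tridiag_form_between; rewrite -hA; apply: lambda_form_between.
have [dfs dbs] : (forall k, (1 <= k <= N./2 - 1)%N -> (df k)^T = df k) /\
    (forall k, (N./2 <= k <= N)%N -> (db k)^T = db k).
  by apply: (@two_filter_sym R n N b c) => //; [lia | rewrite -hA].
case: hd => f1 fS bN bS; split=> k Hk; apply: form_between_lambda => //.
- exact: dfs.
- have dP : pivots (N./2 - 1) b c df by split.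
  case: k Hk => // k Hk.
  by apply: (pivots_form_between _ _ _ _ _ _ _ haL _ dP Hb); lia.
- exact: dbs.
(* The backward recursion runs from N down to N./2, which is
   (N - N./2).+1 pivots. *)
pose d k := db (N.+1 - k)%N.
have dP : pivots (N - N./2).+1 (fun k => b (N.+1 - k)%N)
    (fun k => (c (N.+2 - k)%N)^T) d.
  split=> [|j Hj]; first by rewrite /d subn1 /= bN.
  rewrite /d bS; last lia.
  rewrite trmxK; have -> : (N.+1 - j.-1 = (N.+1 - j).+1)%N by lia.
  by have -> : (N.+2 - j = (N.+1 - j).+1)%N by lia.
have -> : db k = d (N - k).+1 by rewrite /d; congr db; lia.
by apply: (pivots_form_between _ _ _ _ _ _ _ haL _ dP
  (block_form_between_rev _ _ _ _ _ Hb)); lia.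
Qed.
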